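(* Let $G$ be an embedded graph and $n$ a positive integer. Then \[ P(G;n)=\sum_{s}(-1)^{cr(s)}, \] where the sum is over all admissible $n$-valuations $s$ of the medial graph $G_m$ and $cr(s)$ is the number of vertices of $G_m$ at which $s$ is of crossing type.
   Context: An embedded graph is a graph cellularly embedded in a closed (possibly non-orientable) surface. The medial graph $G_m$ has a degree-4 vertex $v_e$ on each edge $e$ of $G$, with edges following face boundaries of $G$ (an isolated vertex contributes a vertex-free closed curve); faces of $G_m$ containing a vertex of $G$ are black, others white. At $v_e$: the white split pairs consecutive half-edges bounding white corners, the black split those bounding black corners, the crossing pairs opposite half-edges. A state chooses a vertex state at each vertex; $c$ = number of resulting closed curves, $cr$ = number of crossings; Penrose states have no black split; $P(G;\lambda)=\sum_{\text{Penrose } t}(-1)^{cr(t)}\lambda^{c(t)}$. An $n$-valuation of $G_m$ is a colouring $\phi:E(G_m)\to\{1,\dots,n\}$ such that at every vertex each colour occurs on an even number of the four incident half-edges. It is admissible if at every vertex either (white-split type) the two half-edges of one white-split pair have colour $i$ and the other pair colour $j$, $i\neq j$, or (crossing type) the two pairs of opposite half-edges have colours $i$ and $j$ respectively, $i\neq j$. *)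

(* Defs.v *)
From HB Require Import structures.
From mathcomp Require Import all_boot all_order all_algebra.

Set Implicit Arguments.
Unset Strict Implicit.
Unset Printing Implicit Defensive.

Import GRing.Theory.
Local Open Scope ring_scope.

(* A graph cellularly embedded in a closed, possibly non-orientable and       *)
(* possibly disconnected, surface, given by its flags.  Each edge carries     *)
(* four flags, one for each choice of an end and a side of the edge:          *)
(*   fl0 x : same edge and side (hence same face), other end;                 *)
(*   fl1 x : same vertex and face, next edge around that corner of the face;  *)
(*   fl2 x : same edge and end, other side.                                   *)
(* Absence of fixed points means that the surface has no boundary.  Edges are *)
(* the orbits of <fl0, fl2>, non-isolated vertices those of <fl1, fl2>, faces *)
(* those of <fl0, fl1>.  A vertex carrying no flag is isolated: it lies alone *)
(* on a sphere component.                                                     *)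
Record embedded_graph := EmbeddedGraph {
  vertex : finType;
  edge : finType;
  flag : finType;
  flag_vertex : flag -> vertex;
  flag_edge : flag -> edge;
  fl0 : flag -> flag;
  fl1 : flag -> flag;
  fl2 : flag -> flag;
  fl0K : involutive fl0;
  fl1K : involutive fl1;
  fl2K : involutive fl2;
  fl0_neq : forall x, fl0 x != x;
  fl1_neq : forall x, fl1 x != x;
  fl2_neq : forall x, fl2 x != x;
  fl02C : forall x, fl0 (fl2 x) = fl2 (fl0 x);
  fl02_neq : forall x, fl0 (fl2 x) != x;
  flag_edge_onto : forall e, exists x, flag_edge x = e;
  flag_edgeP : forall x y, flag_edge x = flag_edge y <->
    y \in [:: x; fl0 x; fl2 x; fl0 (fl2 x)];
  flag_vertexP : forall x y, flag_vertex x = flag_vertex y <->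
    connect [rel a b | (b == fl1 a) || (b == fl2 a)] x y
}.

Section Medial.
Variable G : embedded_graph.

Definition isolated : pred (vertex G) :=
  [pred v | [forall x, flag_vertex x != v]].

(* The vertex v_e of the medial graph is represented by e : edge G.  The four *)
(* half-edges of G_m at v_e are the flags of e; in cyclic order around v_e    *)
(* they are x, fl0 x, fl0 (fl2 x), fl2 x.  The corner between x and fl0 x     *)
(* lies in a face of G (white), the one between x and fl2 x contains an end   *)
(* of e (black).                                                              *)
Definition half_edges (e : edge G) : {set flag G} :=
  [set x | flag_edge x == e].

(* An edge of G_m cuts off the corner {x, fl1 x} of G at a vertex, and its    *)
(* two half-edges are x and fl1 x.                                            *)
Definition corners : {set {set flag G}} := [set [set x; fl1 x] | x : flag G].

(* The second summand accounts for the vertex-free closed curves.             *)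
Definition medial_edge : finType :=
  ({c : {set flag G} | c \in corners} + {v : vertex G | isolated v})%type.

Lemma cornerP (x : flag G) : [set x; fl1 x] \in corners.
Proof. exact: imset_f. Qed.

Definition medial_edge_of (x : flag G) : medial_edge :=
  inl (exist _ [set x; fl1 x] (cornerP x)).

End Medial.

Inductive vertex_state := WhiteSplit | BlackSplit | Crossing.

Definition vertex_state_ord (s : vertex_state) : 'I_3 :=
  match s with WhiteSplit => inord 0 | BlackSplit => inord 1
             | Crossing => inord 2 end.
Definition ord_vertex_state (i : 'I_3) : vertex_state :=
  match val i with 0%N => WhiteSplit | 1%N => BlackSplit | _ => Crossing end.
Lemma vertex_state_ordK : cancel vertex_state_ord ord_vertex_state.
Proof. by case; rewrite /ord_vertex_state /= inordK. Qed.

HB.instance Definition _ := Finite.copy vertex_state (can_type vertex_state_ordK).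

Section Penrose.
Variable G : embedded_graph.

(* The half-edge paired with x at its medial vertex.                          *)
Definition partner (s : vertex_state) (x : flag G) : flag G :=
  match s with
  | WhiteSplit => fl0 x
  | BlackSplit => fl2 x
  | Crossing => fl0 (fl2 x)
  end.

Definition state : finType := {ffun edge G -> vertex_state}.

(* Half-edges are joined along the edges of G_m and through its vertices; the *)
(* vertex-free curves are counted separately.                                 *)
Definition ncurves (t : state) : nat :=
  (n_comp [rel x y | (y == fl1 x) || (y == partner (t (flag_edge x)) x)]
     (flag G) + #|isolated (G := G)|)%N.

Definition ncrossings (t : state) : nat := #|[set e | t e == Crossing]|.

Definition penrose_state (t : state) : bool :=
  [forall e, t e != BlackSplit].

Definition penrose_poly : {poly int} :=
  \sum_(t : state | penrose_state t) (-1) ^+ ncrossings t *: 'X^(ncurves t).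

Variable n : nat.

Definition colouring : finType := {ffun medial_edge G -> 'I_n}.

Definition valuation (phi : colouring) : bool :=
  [forall e, forall i : 'I_n,
    ~~ odd #|[set x in half_edges e | phi (medial_edge_of x) == i]|].

Definition has_type (phi : colouring) (s : vertex_state) (e : edge G) : bool :=
  [exists x in half_edges e, exists i : 'I_n, exists j : 'I_n, (i != j) &&
    [forall y in half_edges e, phi (medial_edge_of y) ==
       (if y \in [set x; partner s x] then i else j)]].

Definition admissible (phi : colouring) : bool :=
  valuation phi &&
  [forall e, has_type phi WhiteSplit e || has_type phi Crossing e].

Definition val_ncrossings (phi : colouring) : nat :=
  #|[set e | has_type phi Crossing e]|.

End Penrose.

(* Main.v *)
Require Import Defs.
From mathcomp Require Import all_boot all_order all_algebra.

(** Call a colouring of the medial edges compatible with a state if it is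
    constant along the curves of the state; there are [n ^ c(t)] such colourings
    of [t].  Expanding [P(G; n)] accordingly and exchanging the two sums, a
    colouring contributes the product over the medial vertices of
    [(compatible with the white split) - (compatible with the crossing)].  This
    factor is [1] at a vertex of white-split type, [-1] at one of crossing type,
    and [0] otherwise.  The parity condition of a valuation is automatic at a
    vertex of either type, since the pairing there is a colour-preserving
    involution without fixed points. *)

Set Implicit Arguments.
Unset Strict Implicit.
Unset Printing Implicit Defensive.

Import GRing.Theory.
Local Open Scope ring_scope.

Lemma expr_card (R : pzSemiRingType) (T : finType) (P : pred T) (a : R) :
  a ^+ #|[set x | P x]| = \prod_x a ^+ P x.
Proof. by rewrite prodrXr -sum1dep_card big_mkcond. Qed.

Lemma prodr_if_forall (R : comPzSemiRingType) (T : finType) (P : pred T)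
    (F : T -> R) :
  \prod_x (if P x then F x else 0) = if [forall x, P x] then \prod_x F x else 0.
Proof.
have [/forallP Pall | /forallPn[x /negbTE nPx]] := boolP [forall x, P x].
  by apply: eq_bigr => x _; rewrite Pall.
by rewrite (bigD1 x) //= nPx mul0r.
Qed.

Lemma even_card_fixfree_involution (T : finType) (f : T -> T) (A : {pred T}) :
    involutive f -> (forall x, f x != x) ->
    (forall x, (f x \in A) = (x \in A)) ->
  ~~ odd #|A|.
Proof.
move=> fK f_neq fA.
have order2 x : order f x = 2%N.
  apply: (@order_cycle _ f [:: x; f x]); last exact: mem_head.
    by rewrite /= fK !eqxx.
  by rewrite /= inE eq_sym f_neq.
rewrite -(@fcard_order_set _ f (can_inj fK) 2 A) ?muln2 ?odd_double //.
  by apply/subsetP => x _; rewrite inE order2.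
by move=> x y /eqP <-; rewrite fA.
Qed.

Section ConstantAlong.
Variables (T : finType) (e : rel T).

Definition constant_along (D : eqType) (f : T -> D) : bool :=
  [forall x, forall y, e x y ==> (f x == f y)].

Lemma constant_alongP (D : eqType) (f : T -> D) :
  reflect (forall x y, e x y -> f x = f y) (constant_along f).
Proof.
apply: (iffP 'forall_'forall_implyP) => f_const x y exy.
  by apply/eqP/f_const.
by rewrite (f_const x y).
Qed.

Lemma constant_along_connect (D : eqType) (f : T -> D) x y :
  constant_along f -> connect e x y -> f x = f y.
Proof.
move=> /constant_alongP f_const /connectP[p + ->] {y}.
by elim: p x => //= y p IHp x /andP[/f_const -> /IHp].
Qed.

Lemma card_constant_along (D : finType) : connect_sym e ->
  #|[set f : {ffun T -> D} | constant_along f]| = (#|D| ^ n_comp e T)%N.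
Proof.
move=> e_sym; pose component x := exist (roots e) _ (roots_root e_sym x).
pose pull (g : {ffun {x | roots e x} -> D}) := [ffun x => g (component x)].
have pull_inj : injective pull.
  move=> g h /ffunP eq_gh; apply/ffunP => -[x rx]; move/(_ x): eq_gh.
  rewrite !ffunE; suff -> : component x = exist _ x rx by [].
  by apply: val_inj; apply/eqP.
have -> : n_comp e T = #|{: {x | roots e x}}|.
  by rewrite card_sig; apply: eq_card => x; rewrite !inE andbT.
rewrite -card_ffun -(card_imset _ pull_inj); apply: eq_card => f; rewrite inE.
apply/idP/imsetP => [f_const | [g _ ->]].
  exists [ffun r => f (sval r)] => //; apply/ffunP => x; rewrite !ffunE.
  exact: constant_along_connect f_const (connect_root _ _).
apply/constant_alongP => x y exy; rewrite !ffunE; congr (g _).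
by apply/val_inj/eqP; rewrite /= root_connect // connect1.
Qed.

End ConstantAlong.

Section Partners.
Variable G : embedded_graph.
Implicit Types (s : vertex_state) (x y : flag G).

Lemma partnerK s : involutive (@partner G s).
Proof. by case: s => x /=; rewrite ?fl0K ?fl2K // fl02C fl0K fl2K. Qed.

Lemma partner_neq s x : partner s x != x.
Proof. by case: s => /=; rewrite ?fl0_neq ?fl2_neq ?fl02_neq. Qed.

Lemma partner_edge s x : flag_edge (partner s x) = flag_edge x.
Proof. by apply/esym/flag_edgeP; case: s => /=; rewrite !inE eqxx ?orbT. Qed.

Lemma edge_flags_uniq x : uniq [:: x; fl0 x; fl2 x; fl0 (fl2 x)].
Proof.
have fl0_inj := can_inj (@fl0K G); have fl2_inj := can_inj (@fl2K G).
have neq02 : fl0 x != fl2 x by rewrite -(inj_eq fl2_inj) fl2K -fl02C fl02_neq.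
rewrite /= !inE !negb_or neq02 (inj_eq fl0_inj).
rewrite ![_ == fl0 _]eq_sym ![x == _]eq_sym.
by rewrite fl0_neq !fl2_neq fl02_neq fl0_neq.
Qed.

Lemma partner_state_inj x : injective (fun s => partner s x).
Proof.
have := edge_flags_uniq x; rewrite /= !inE.
case/and4P=> _ /norP[/eqP neq02 /eqP neq0_02] /eqP neq2_02 _.
by case=> [] [] //= eq_partners; congruence.
Qed.

Lemma partner_mem_pair s x y :
  (partner s y \in [set x; partner s x]) = (y \in [set x; partner s x]).
Proof.
rewrite !inE (can2_eq (partnerK s) (partnerK s)).
by rewrite (inj_eq (can_inj (partnerK s))) orbC.
Qed.

Lemma partner_notin_pair s s' x :
  s' != s -> partner s' x \notin [set x; partner s x].
Proof.
move=> neq_s; rewrite !inE negb_or partner_neq.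
by rewrite (inj_eq (@partner_state_inj x)).
Qed.

Lemma half_edges_pairs s s' x : s' != s ->
  half_edges (flag_edge x) =
    [set x; partner s x] :|: [set partner s' x; partner s (partner s' x)].
Proof.
move=> neq_s; apply/setP => y; rewrite [in LHS]inE eq_sym.
have -> : (flag_edge x == flag_edge y) =
    (y \in [:: x; fl0 x; fl2 x; fl0 (fl2 x)]).
  by apply/eqP/idP => /flag_edgeP.
rewrite !inE; case: s s' neq_s => [] [] //= /eqP // _;
  rewrite ?fl02C ?fl0K ?fl2K -?fl02C ?fl0K ?fl2K;
  by do 4! case: (y == _).
Qed.

End Partners.

Section Curves.
Variables (G : embedded_graph) (t : state G).

Definition curve_rel : rel (flag G) :=
  [rel x y | (y == fl1 x) || (y == partner (t (flag_edge x)) x)].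

Lemma curve_connect_sym : connect_sym curve_rel.
Proof.
suff rel_sym x y : curve_rel x y -> curve_rel y x.
  by apply: sym_connect_sym => x y; apply/idP/idP => /rel_sym.
case/orP => /eqP ->; rewrite /curve_rel /= ?fl1K ?eqxx //.
by rewrite partner_edge partnerK eqxx orbT.
Qed.

End Curves.

Section MedialEdges.
Variable G : embedded_graph.

Lemma medial_edge_of_fl1 (x : flag G) :
  medial_edge_of (fl1 x) = medial_edge_of x.
Proof. by congr inl; apply: val_inj; rewrite /= fl1K setUC. Qed.

Lemma medial_edge_of_onto (c : {c : {set flag G} | c \in corners G}) :
  exists x, medial_edge_of x == inl c.
Proof.
have /imsetP[x _ cE] := svalP c; exists x.
by apply/eqP; congr inl; apply: val_inj.
Qed.

Definition corner_flag (c : {c : {set flag G} | c \in corners G}) : flag G :=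
  xchoose (medial_edge_of_onto c).

Lemma corner_flagK c : medial_edge_of (corner_flag c) = inl c.
Proof. exact/eqP/(xchooseP (medial_edge_of_onto c)). Qed.

Lemma corner_flag_eq x c :
  medial_edge_of x = inl c -> corner_flag c = x \/ corner_flag c = fl1 x.
Proof.
rewrite -corner_flagK => -[/setP/(_ (corner_flag c))].
by rewrite !inE eqxx => /orP[] /eqP; [left | right].
Qed.

End MedialEdges.

Section Colourings.
Variables (G : embedded_graph) (n : nat).
Implicit Types (s : vertex_state) (e : edge G) (x y : flag G).
Implicit Types (t : state G) (phi : colouring G n).

Definition compatible_at phi s e : bool :=
  [forall x in half_edges e,
     phi (medial_edge_of (partner s x)) == phi (medial_edge_of x)].

Lemma compatible_atP phi s e :
  reflect (forall x, flag_edge x = e ->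
             phi (medial_edge_of (partner s x)) = phi (medial_edge_of x))
          (compatible_at phi s e).
Proof.
apply: (iffP forall_inP) => phi_s x.
  by move=> xe; apply/eqP/phi_s; rewrite inE xe.
by rewrite inE => /eqP/phi_s ->.
Qed.

Lemma has_typeP phi s e :
  reflect (exists x (i j : 'I_n), [/\ flag_edge x = e, i != j &
             forall y, flag_edge y = e -> phi (medial_edge_of y) =
               if y \in [set x; partner s x] then i else j])
          (has_type phi s e).
Proof.
apply: (iffP existsP) => [[x] | [x [i [j [xe neq_ij phiE]]]]].
  rewrite inE => /andP[/eqP xe /existsP[i /existsP[j]]].
  case/andP=> neq_ij /forall_inP phiE.
  by exists x, i, j; split=> // y ye; apply/eqP/phiE; rewrite inE ye.
exists x; rewrite inE xe eqxx; apply/existsP; exists i; apply/existsP; exists j.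
by rewrite neq_ij; apply/forall_inP => y; rewrite inE => /eqP/phiE ->.
Qed.

Lemma has_type_compatible_at phi s e :
  has_type phi s e -> compatible_at phi s e.
Proof.
case/has_typeP => x [i [j [_ _ phiE]]]; apply/compatible_atP => y ye.
by rewrite !phiE ?partner_edge ?partner_mem_pair.
Qed.

Lemma has_typeE phi s s' e : s' != s ->
  has_type phi s e = compatible_at phi s e && ~~ compatible_at phi s' e.
Proof.
move=> neq_s; apply/idP/andP => [phi_s | [/compatible_atP phi_s]].
  split; first exact: has_type_compatible_at.
  have /has_typeP[x [i [j [xe neq_ij phiE]]]] := phi_s.
  apply: contraNN neq_ij => /compatible_atP/(_ x xe).
  rewrite !phiE ?partner_edge // (negbTE (partner_notin_pair _ neq_s)).
  by rewrite set21 => ->.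
case/forall_inPn => x; rewrite inE => /eqP xe neq_s'.
apply/has_typeP.
exists x, (phi (medial_edge_of x)), (phi (medial_edge_of (partner s' x))).
split=> // [|y ye]; first by rewrite eq_sym.
have : y \in half_edges (flag_edge x) by rewrite inE xe ye.
rewrite (half_edges_pairs x neq_s) in_setU.
case: ifP => [/set2P[]-> // _ | _ /set2P[]-> //]; first exact: phi_s.
by rewrite phi_s ?partner_edge.
Qed.

Lemma compatible_at_even phi s e (i : 'I_n) : compatible_at phi s e ->
  ~~ odd #|[set x in half_edges e | phi (medial_edge_of x) == i]|.
Proof.
move/compatible_atP => phi_s.
apply: (@even_card_fixfree_involution _ (partner s)).
- exact: partnerK.
- exact: partner_neq.
- by move=> x; rewrite !inE partner_edge; case: eqP => //= /phi_s ->.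
Qed.

Lemma admissibleE phi : admissible phi =
  [forall e, has_type phi WhiteSplit e || has_type phi Crossing e].
Proof.
rewrite /admissible andb_idl // => /forallP phi_type.
apply/forallP => e; apply/forallP => i.
by case/orP: (phi_type e) => /has_type_compatible_at; exact: compatible_at_even.
Qed.

Definition compatible t phi : bool :=
  constant_along (curve_rel t) (fun x => phi (medial_edge_of x)).

Lemma compatibleE t phi :
  compatible t phi = [forall e, compatible_at phi (t e) e].
Proof.
apply/constant_alongP/forallP => [phi_t e | phi_t x y].
  apply/compatible_atP => x <-; apply/esym/phi_t.
  by rewrite /curve_rel /= eqxx orbT.
case/orP => /eqP ->; first by rewrite medial_edge_of_fl1.
by rewrite (compatible_atP _ _ _ (phi_t (flag_edge x))).
Qed.

Definition flag_isolated_colours phi :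
    {ffun flag G -> 'I_n} * {ffun {v | @isolated G v} -> 'I_n} :=
  ([ffun x => phi (medial_edge_of x)], [ffun v => phi (inr v)]).

Lemma flag_isolated_colours_inj : injective flag_isolated_colours.
Proof.
move=> phi psi [/ffunP eq_flags /ffunP eq_isolated]; apply/ffunP => -[c | v].
  by have := eq_flags (corner_flag c); rewrite !ffunE corner_flagK.
by have := eq_isolated v; rewrite !ffunE.
Qed.

Lemma imset_compatible t :
  flag_isolated_colours @: [set phi | compatible t phi] =
  setX [set f : {ffun flag G -> 'I_n} | constant_along (curve_rel t) f] setT.
Proof.
apply/setP => -[f g]; rewrite !inE andbT; apply/imsetP/constant_alongP => /=.
  case=> phi; rewrite inE => /constant_alongP phi_t [-> _] x y /phi_t.
  by rewrite !ffunE.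
move=> f_t; pose phi : colouring G n :=
  [ffun m => match m with inl c => f (corner_flag c) | inr v => g v end].
have phi_flag x : phi (medial_edge_of x) = f x.
  rewrite ffunE /=; case: (corner_flag_eq (erefl (medial_edge_of x))) => -> //.
  by apply/esym/f_t; rewrite /curve_rel /= eqxx.
exists phi.
  by rewrite inE; apply/constant_alongP => x y /f_t; rewrite !phi_flag.
by congr pair; apply/ffunP => z; rewrite ffunE ?phi_flag // ffunE.
Qed.

Lemma card_compatible t : #|[set phi | compatible t phi]| = (n ^ ncurves t)%N.
Proof.
rewrite -(card_imset _ flag_isolated_colours_inj) imset_compatible cardsX.
rewrite card_constant_along; last exact: curve_connect_sym.
by rewrite cardsT card_ffun card_sig card_ord -expnD.
Qed.

Lemma sum_compatible_vertex_state (R : pzRingType) phi e :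
  \sum_(s | (s != BlackSplit) && compatible_at phi s e)
     (-1) ^+ (s == Crossing) =
  (compatible_at phi WhiteSplit e)%:R - (compatible_at phi Crossing e)%:R :> R.
Proof.
have neqCW : Crossing != WhiteSplit by apply/eqP.
have neqWB : WhiteSplit != BlackSplit by apply/eqP.
have neqCB : Crossing != BlackSplit by apply/eqP.
rewrite big_mkcond (bigD1 WhiteSplit) //= (bigD1 Crossing) //= big1 => [|[]];
  rewrite ?eqxx ?andbF //.
rewrite addr0 neqWB neqCB [WhiteSplit == _]eq_sym (negbTE neqCW) /=.
by congr (_ + _); case: (compatible_at _ _ _); rewrite ?oppr0.
Qed.

Lemma compatible_at_diff (R : pzRingType) phi e :
  (compatible_at phi WhiteSplit e)%:R - (compatible_at phi Crossing e)%:R =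
  if has_type phi WhiteSplit e || has_type phi Crossing e
  then (-1) ^+ has_type phi Crossing e else 0 :> R.
Proof.
have neqCW : Crossing != WhiteSplit by apply/eqP.
have neqWC : WhiteSplit != Crossing by apply/eqP.
rewrite (has_typeE phi e neqCW) (has_typeE phi e neqWC).
by do 2! case: (compatible_at _ _ _); rewrite /= ?subrr ?subr0 ?add0r.
Qed.

Lemma sum_compatible_penrose_state (R : comPzRingType) phi :
  \sum_(t : state G | penrose_state t && compatible t phi)
     (-1) ^+ ncrossings t =
  (if admissible phi then (-1) ^+ val_ncrossings phi else 0) :> R.
Proof.
transitivity (\prod_e \sum_(s | (s != BlackSplit) && compatible_at phi s e)
    (-1) ^+ (s == Crossing) : R).
  rewrite bigA_distr_big_dep; apply: eq_big => [t | t _]; last exact: expr_card.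
  rewrite compatibleE; apply/andP/familyP => [[] | t_phi].
    move=> /forallP t_penrose /forallP phi_t e.
    by rewrite unfold_in /= t_penrose phi_t.
  by split; apply/forallP => e; have /andP[] := t_phi e.
rewrite admissibleE /val_ncrossings expr_card -prodr_if_forall.
apply: eq_bigr => e _.
by rewrite sum_compatible_vertex_state compatible_at_diff.
Qed.

End Colourings.

Theorem theorem6p8 (G : embedded_graph) (n : nat) (hn : (0 < n)%N) :
  (penrose_poly G).[n%:R] =
  \sum_(s : colouring G n | admissible s) (-1) ^+ val_ncrossings s.
Proof.
rewrite /penrose_poly horner_sum.
transitivity (\sum_(t : state G | penrose_state t)
    \sum_(phi : colouring G n | compatible t phi) (-1) ^+ ncrossings t : int).
  apply: eq_bigr => t _; rewrite hornerZ hornerXn -natrX -card_compatible.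
  by rewrite mulr_natr sumr_const cardsE.
rewrite (exchange_big_dep predT) //= [RHS]big_mkcond.
by apply: eq_bigr => phi _; exact: sum_compatible_penrose_state.
Qed.
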